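(* Let $A \in \mathbb{R}^{n \times n}$ be symmetric positive semidefinite, $\mathbf{b} \in \mathbb{R}^n$, $c \in \mathbb{R}$, $D \in \mathbb{R}^{M \times n}$, $\mathbf{d} \in \mathbb{R}^M$, and let $f(\mathbf{x}) = \frac{1}{2}\mathbf{x}^{\top}A\mathbf{x} + \mathbf{b}^{\top}\mathbf{x} + c$ and $\mathbf{g}(\mathbf{x}) = D\mathbf{x} + \mathbf{d}$. Let $\Gamma_x \in \mathbb{R}^{n\times n}$ and $\Gamma_\lambda \in \mathbb{R}^{M \times M}$ be diagonal positive definite matrices and let $\Gamma$ be the block-diagonal matrix with diagonal blocks $\Gamma_x$ and $\Gamma_\lambda$. For $p > 0$ let $$\mathcal{L}_p(\mathbf{x}, \boldsymbol{\lambda}) := f(\mathbf{x}) + \boldsymbol{\lambda}^{\top}\mathbf{g}(\mathbf{x}) + \frac{p}{2}\mathbf{x}^{\top}\Gamma_x^{-1}\mathbf{x} - \frac{p}{2}\boldsymbol{\lambda}^{\top}\Gamma_\lambda^{-1}\boldsymbol{\lambda},$$ and, with $\mathbf{z} := (\mathbf{x}^{\top}, \boldsymbol{\lambda}^{\top})^{\top} \in \mathbb{R}^{n+M}$, let $$\tilde\Phi(\mathbf{z}) := \Gamma \begin{bmatrix} \nabla_{\mathbf{x}}\mathcal{L}_p(\mathbf{z}) \\ -\nabla_{\boldsymbol{\lambda}}\mathcal{L}_p(\mathbf{z}) \end{bmatrix}.$$ Let $$W := \begin{bmatrix} A & D^{\top} \\ -D & \mathbf{0} \end{bmatrix}, \qquad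 V := \tfrac{1}{2}(\Gamma W + W^{\top}\Gamma),$$ and let $\lambda_{\min}$ be the smallest eigenvalue of $V$. If $p > \max\{0, -\lambda_{\min}\}$, then $\tilde\Phi$ is strongly monotone with parameter $\eta := p + \min\{0, \lambda_{\min}\}$.
   Context: A map $\Psi : \mathbb{R}^{m} \to \mathbb{R}^{m}$ is strongly monotone with parameter $\eta > 0$ if $(\Psi(\mathbf{z}_1) - \Psi(\mathbf{z}_2))^{\top}(\mathbf{z}_1 - \mathbf{z}_2) \geq \eta \|\mathbf{z}_1 - \mathbf{z}_2\|_2^2$ for all $\mathbf{z}_1, \mathbf{z}_2 \in \mathbb{R}^{m}$. *)

(* Defs.v *)
From mathcomp Require Import all_boot all_order all_algebra.
From mathcomp Require Import all_classical all_reals all_analysis.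

Set Implicit Arguments.
Unset Strict Implicit.
Unset Printing Implicit Defensive.

Import Order.TTheory GRing.Theory Num.Theory.
Import numFieldNormedType.Exports.

Local Open Scope ring_scope.

Definition dot (R : realType) (m : nat) (u v : 'cV[R]_m) : R :=
  (u^T *m v) 0 0.

Definition quad (R : realType) (m : nat) (B : 'M[R]_m) (u : 'cV[R]_m) : R :=
  (u^T *m B *m u) 0 0.

(* The library norm `|u| on matrices is the max norm, not this one. *)
Definition norm2 (R : realType) (m : nat) (u : 'cV[R]_m) : R :=
  Num.sqrt (\sum_(i < m) u i 0 ^+ 2).

Definition symmetric_mx (R : realType) (m : nat) (B : 'M[R]_m) : Prop :=
  B^T = B.

Definition posdef (R : realType) (m : nat) (B : 'M[R]_m) : Prop :=
  symmetric_mx B /\ forall u : 'cV[R]_m, u != 0 -> 0 < quad B u.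

Definition possemidef (R : realType) (m : nat) (B : 'M[R]_m) : Prop :=
  symmetric_mx B /\ forall u : 'cV[R]_m, 0 <= quad B u.

(* [eigenvalue] is stated with row eigenvectors; a square matrix and its
   transpose have the same eigenvalues. *)
Definition smallest_eigenvalue (R : realType) (m : nat) (B : 'M[R]_m) (l : R) :
  Prop := eigenvalue B l /\ forall a : R, eigenvalue B a -> l <= a.

Definition strongly_monotone (R : realType) (m : nat) (eta : R)
    (Psi : 'cV[R]_m -> 'cV[R]_m) : Prop :=
  0 < eta /\ forall z1 z2 : 'cV[R]_m,
    eta * norm2 (z1 - z2) ^+ 2 <= dot (Psi z1 - Psi z2) (z1 - z2).

(* [delta_mx i 0] is the i-th standard basis vector, so the entries are the
   partial derivatives of F. *)
Definition grad (R : realType) (m : nat) (F : 'cV[R]_m -> R) (u : 'cV[R]_m) :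
  'cV[R]_m := \col_i ('D_(delta_mx i 0) F u).

Definition objective (R : realType) (n : nat) (A : 'M[R]_n) (b : 'cV[R]_n)
    (c : R) (x : 'cV[R]_n) : R :=
  2^-1 * quad A x + dot b x + c.

Definition constraint (R : realType) (n M : nat) (D : 'M[R]_(M, n))
    (d : 'cV[R]_M) (x : 'cV[R]_n) : 'cV[R]_M :=
  D *m x + d.

Definition reg_lagrangian (R : realType) (n M : nat) (f : 'cV[R]_n -> R)
    (g : 'cV[R]_n -> 'cV[R]_M) (Gx : 'M[R]_n) (Gl : 'M[R]_M) (p : R)
    (x : 'cV[R]_n) (lam : 'cV[R]_M) : R :=
  f x + dot lam (g x)
  + p / 2 * quad (invmx Gx) x - p / 2 * quad (invmx Gl) lam.

Definition block_diag (R : realType) (n M : nat) (Gx : 'M[R]_n)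
    (Gl : 'M[R]_M) : 'M[R]_(n + M) :=
  block_mx Gx 0 0 Gl.

(* z stacks x = usubmx z on top of lambda = dsubmx z. *)
Definition saddle_map (R : realType) (n M : nat)
    (L : 'cV[R]_n -> 'cV[R]_M -> R) (G : 'M[R]_(n + M))
    (z : 'cV[R]_(n + M)) : 'cV[R]_(n + M) :=
  G *m col_mx (grad (fun x => L x (dsubmx z)) (usubmx z))
              (- grad (fun lam => L (usubmx z) lam) (dsubmx z)).

Definition Wmx (R : realType) (n M : nat) (A : 'M[R]_n) (D : 'M[R]_(M, n)) :
  'M[R]_(n + M) := block_mx A D^T (- D) 0.

Definition Vmx (R : realType) (m : nat) (G W : 'M[R]_m) : 'M[R]_m :=
  2^-1 *: (G *m W + W^T *m G).

(* Main.v *)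
(** The gradient of [L_p] is affine, and multiplying by [Gamma] turns the
    regularisation term [p Gamma^-1 z] into [p z]; hence the saddle map is
    [z |-> (Gamma W + p I) z + const].  Its monotonicity form at [u = z1 - z2]
    is therefore [u^T V u + p |u|^2], with [V] the symmetric part of
    [Gamma W], and it remains to bound [u^T V u] below by [lmin |u|^2].  For
    that, minimise [v V v^T] on the (compact) unit sphere: if [mu] is the
    minimum, [V - mu I] is positive semidefinite and its form vanishes at the
    minimiser, which is thus in the kernel, so that [mu] is an eigenvalue. *)
Require Import Defs.
From mathcomp Require Import all_boot all_order all_algebra.
From mathcomp Require Import all_classical all_reals all_analysis.
From mathcomp Require Import ring lra.

Import Order.TTheory GRing.Theory Num.Theory.
Import numFieldNormedType.Exports.

Local Open Scope classical_set_scope.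
Local Open Scope ring_scope.

(** * Euclidean inner product *)

Section Dot.
Context {R : realType} {m : nat}.
Implicit Types (u v w : 'cV[R]_m) (a : R).

Lemma dotE u v : dot u v = \sum_i u i 0 * v i 0.
Proof. by rewrite /dot mxE; apply: eq_bigr => i _; rewrite mxE. Qed.

Lemma dotC u v : dot u v = dot v u.
Proof. by rewrite !dotE; apply: eq_bigr => i _; rewrite mulrC. Qed.

Lemma dotDl u v w : dot (u + v) w = dot u w + dot v w.
Proof. by rewrite /dot linearD mulmxDl mxE. Qed.

Lemma dotZl a u v : dot (a *: u) v = a * dot u v.
Proof. by rewrite /dot linearZ -scalemxAl mxE. Qed.

Lemma dotDr u v w : dot u (v + w) = dot u v + dot u w.
Proof. by rewrite dotC dotDl !(dotC u). Qed.

Lemma dotZr a u v : dot u (a *: v) = a * dot u v.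
Proof. by rewrite dotC dotZl (dotC u). Qed.

Lemma dot_delta i u : dot (delta_mx i 0) u = u i 0.
Proof.
rewrite dotE (bigD1 i)//= mxE !eqxx mul1r big1 ?addr0// => j jNi.
by rewrite mxE (negPf jNi) mul0r.
Qed.

Lemma dot_ge0 u : 0 <= dot u u.
Proof. by rewrite dotE sumr_ge0// => i _; rewrite -expr2 sqr_ge0. Qed.

Lemma dot_eq0 u : dot u u = 0 -> u = 0.
Proof.
rewrite dotE => /eqP; rewrite psumr_eq0; last first.
  by move=> i _; rewrite -expr2 sqr_ge0.
move=> /allP u0; apply/colP => i; rewrite mxE.
by have /= := u0 i (mem_index_enum i); rewrite mulf_eq0 orbb => /eqP.
Qed.

Lemma norm2_sqr u : norm2 u ^+ 2 = dot u u.
Proof.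
rewrite /norm2 sqr_sqrtr ?dotE; last by rewrite sumr_ge0// => i _; rewrite sqr_ge0.
by apply: eq_bigr => i _; rewrite expr2.
Qed.

End Dot.

Lemma dot_mul {R : realType} {m k : nat} (B : 'M[R]_(m, k)) u v :
  dot u (B *m v) = dot (B^T *m u) v.
Proof. by rewrite /dot trmx_mul trmxK mulmxA. Qed.

(** * Quadratic forms *)

Section Quad.
Context {R : realType} {m : nat}.
Implicit Types (u v : 'cV[R]_m) (a : R) (B C : 'M[R]_m).

Lemma quadE B u : quad B u = dot u (B *m u).
Proof. by rewrite /quad /dot mulmxA. Qed.

Lemma quadD B C u : quad (B + C) u = quad B u + quad C u.
Proof. by rewrite !quadE mulmxDl dotDr. Qed.

Lemma quadZ a B u : quad (a *: B) u = a * quad B u.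
Proof. by rewrite !quadE -scalemxAl dotZr. Qed.

(** Symmetry merges the two cross terms. The coefficient of [a] serves both as a first variation and
    as a directional derivative. *)
Lemma quad_line B a u v : symmetric_mx B ->
  quad B (a *: v + u) = quad B u + a * (2 * dot v (B *m u)) + a ^+ 2 * quad B v.
Proof.
move=> Bs; rewrite !quadE !mulmxDr !dotDl !dotDr -!scalemxAr !dotZl !dotZr.
by rewrite [dot u (B *m v)]dot_mul Bs [dot (B *m u) v]dotC; ring.
Qed.

Lemma quad_row_sum B (v : 'rV[R]_m) :
  quad B v^T = \sum_i \sum_j v 0 i * B i j * v 0 j.
Proof.
rewrite quadE dotE; apply: eq_bigr => i _; rewrite !mxE big_distrr/=.
by apply: eq_bigr => j _; rewrite !mxE mulrA.
Qed.

(** Such a [u] minimises the form, so the first variation at [u] in the direction [B *m u], which is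
    twice the squared norm of [B *m u], must vanish. *)
Lemma possemidef_ker B u : possemidef B -> quad B u = 0 -> B *m u = 0.
Proof.
move=> [Bs B0] Bu0; apply: dot_eq0.
set v := B *m u; set a := dot v v; set k := quad B v.
have a0 : 0 <= a by exact: dot_ge0.
have k0 : 0 <= k by exact: B0.
apply/eqP; rewrite eq_le a0 andbT leNgt; apply/negP => a_gt0.
(* Since [k] may be zero, [k + 1] is the denominator. *)
have k1 : 0 < k + 1 by rewrite ltr_wpDl.
(* Evaluating at [t v + u] with [t = - a / (k + 1)] gives a negative value. *)
have := B0 ((- (a / (k + 1))) *: v + u).
rewrite quad_line// Bu0 add0r -/v -/a -/k.
set t := a / (k + 1).
have t0 : 0 < t by rewrite divr_gt0.
have tk : t * (k + 1) = a by rewrite /t divfK// gt_eqF.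
(* The value is [- 2 * t * a + t ^+ 2 * k], and [t * k <= a] bounds it by [- t * a < 0]. *)
nra.
Qed.

Lemma posdef_unitmx B : posdef B -> B \in unitmx.
Proof.
move=> [Bs B0]; rewrite unitmxE unitfE; apply/det0P => -[v vN0 vB].
have := B0 v^T; rewrite /quad trmxK vB mul0mx mxE ltxx.
by rewrite -trmx0 (inj_eq trmx_inj) => /(_ vN0).
Qed.

End Quad.

(** * Lower bound of a form by the smallest eigenvalue *)

Section Rayleigh.
Context {R : realType} {m : nat}.
Implicit Types B : 'M[R]_m.

Lemma quad_row_continuous B : continuous (fun v : 'rV[R]_m => quad B v^T).
Proof.
rewrite (_ : (fun v : 'rV[R]_m => _) = (fun v : 'rV[R]_m =>
  \sum_i \sum_j v 0 i * B i j * v 0 j)); last first.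
  by apply/funext => v; rewrite quad_row_sum.
refine (continuous_big add_continuous _) => i _.
refine (continuous_big add_continuous _) => j _ v.
apply: (@cvgM _ _ _ (nbhs_filter v)); last exact: coord_continuous.
apply: (@cvgM _ _ _ (nbhs_filter v)); first exact: coord_continuous.
exact: cvg_cst.
Qed.

(** The sphere is closed, as the preimage of 1 under a continuous form, and lies in the compact cube
    with sides [[-1, 1]]. Row vectors are used to match [rV_compact]. *)
Lemma sphere_compact : compact [set v : 'rV[R]_m | quad 1%:M v^T = 1].
Proof.
have cube := @rV_compact _ m (fun=> `[-1 : R, 1]%classic)
  (fun=> @segment_compact R (-1) 1).
apply: subclosed_compact cube _.
- have /continuous_closedP quad_closed := @quad_row_continuous 1%:M.
  exact: (quad_closed _ (@closed_eq _ 1)).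
- move=> v /=; rewrite quadE mul1mx dotE => v1 i.
  rewrite in_itv/= -ler_norml -(@expr_le1 _ 2)// real_normK ?num_real//.
  rewrite -v1 (bigD1 i)//= mxE -expr2 lerDl sumr_ge0// => j _.
  by rewrite -expr2 sqr_ge0.
Qed.

Lemma smallest_eigenvalue_le_quad B l (u : 'cV[R]_m) :
  symmetric_mx B -> smallest_eigenvalue B l -> l * dot u u <= quad B u.
Proof.
move=> Bs [/eigenvalueP[w _ wN0] l_min].
have normalize (v : 'cV[R]_m) : v != 0 ->
    exists2 s : R, 0 < s & dot v v = s ^+ 2 /\ dot (s^-1 *: v) (s^-1 *: v) = 1.
  move=> vN0; have v0 : 0 < dot v v.
    by rewrite lt_neqAle dot_ge0 andbT eq_sym; apply: contra_neq vN0 => /dot_eq0.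
  exists (Num.sqrt (dot v v)); first by rewrite sqrtr_gt0.
  rewrite dotZl dotZr mulrA -expr2 exprVn sqr_sqrtr ?dot_ge0//.
  by rewrite mulVf// gt_eqF.
(* The given eigenvector, once normalised, shows that the sphere is nonempty; this excludes
   [m = 0]. *)
have wTN0 : w^T != 0 by rewrite -trmx0 (inj_eq trmx_inj).
have [s _ [_ w1]] := normalize _ wTN0.
have sphereN0 : [set v : 'rV[R]_m | quad 1%:M v^T = 1] !=set0.
  by exists (s^-1 *: w^T)^T; rewrite /= trmxK quadE mul1mx.
have [c cS c_min] := compact_EVT_min sphereN0 sphere_compact
    (continuous_subspaceT (@quad_row_continuous B)).
move: cS; rewrite inE/= quadE mul1mx => c1.
set mu := quad B c^T.
have quad_shift v : quad (B - mu%:M) v = quad B v - mu * dot v v.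
  by rewrite -scalemx1 -scaleNr quadD quadZ (quadE 1%:M) mul1mx mulNr.
(* Homogeneity of degree 2 extends the bound from the unit sphere to all vectors. *)
have mu_min v : mu * dot v v <= quad B v.
  have [->|vN0] := eqVneq v 0.
    by rewrite quadE !mulmx0 -(scale0r 0) dotZl mul0r mulr0.
  have [t t0 [vt v1]] := normalize _ vN0.
  have := c_min (t^-1 *: v)^T; rewrite inE/= !trmxK -/mu quadE mul1mx.
  move=> /(_ v1); rewrite quadE -scalemxAr dotZl dotZr mulrA -expr2 exprVn.
  by rewrite -quadE mulrC ler_pdivlMr ?exprn_gt0// vt.
have psd : possemidef (B - mu%:M).
  split; first by rewrite /symmetric_mx linearB/= Bs tr_scalar_mx.
  by move=> v; rewrite quad_shift subr_ge0.
have ker : (B - mu%:M) *m c^T = 0.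
  by apply: possemidef_ker => //; rewrite quad_shift c1 mulr1 subrr.
(* It remains to see that [mu] is an eigenvalue, whence [l <= mu]. Transposing [ker] turns the
   kernel column [c^T] into the row eigenvector [c]. *)
apply: le_trans (mu_min u); rewrite ler_wpM2r ?dot_ge0// l_min//.
apply/eigenvalueP; exists c.
  move/(congr1 trmx): ker; rewrite trmx_mul trmxK trmx0 psd.1 mulmxBr.
  by rewrite mul_mx_scalar => /eqP; rewrite subr_eq0 => /eqP.
apply/eqP => c0; move: c1; rewrite c0 trmx0 -(scale0r 0) dotZl mul0r => /eqP.
by rewrite eq_sym oner_eq0.
Qed.

End Rayleigh.

(** * Gradients of quadratic functions *)

Lemma derive_quadratic {R : realType} {m : nat} (F : 'cV[R]_m -> R) u v a k :
  (forall h : R, F (h *: v + u) = F u + h * a + h ^+ 2 * k) -> 'D_v F u = a.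
Proof.
move=> Fline; apply: cvg_lim => //.
(* For nonzero [h] the difference quotient is exactly [a + h * k]. *)
have : (fun h : R => a + h * k) h @[h --> 0^'] --> a.
  rewrite -[X in _ --> X]addr0 -[X in _ --> _ + X](mul0r k).
  apply: cvg_within_filter; apply: cvgD; first exact: cvg_cst.
  by apply: cvgM; [exact: cvg_id | exact: cvg_cst].
apply: cvg_trans; apply: near_eq_cvg; near=> h.
have h0 : h != 0 by near: h; exact: nbhs_dnbhs_neq.
by rewrite /= Fline /GRing.scale/=; field.
Unshelve. all: by end_near. Qed.

Lemma grad_quadratic {R : realType} {m : nat} (Q : 'M[R]_m) (q : 'cV[R]_m)
    (r : R) u : symmetric_mx Q ->
  grad (fun x => quad Q x + dot q x + r) u = 2 *: (Q *m u) + q.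
Proof.
move=> Qs; apply/colP => i; rewrite [LHS]mxE.
apply: (@derive_quadratic _ _ _ _ _ _ (quad Q (delta_mx i 0))) => h.
rewrite quad_line// dotDr dotZr [dot q (delta_mx _ _)]dotC !dot_delta.
rewrite [(_ + q) i 0]mxE [X in X + q i 0]mxE.
ring.
Qed.

(** * The saddle map as an affine map *)

Section SaddleMap.
Context {R : realType} {n M : nat}.
Variables (A : 'M[R]_n) (b : 'cV[R]_n) (c : R).
Variables (D : 'M[R]_(M, n)) (d : 'cV[R]_M).
Variables (Gx : 'M[R]_n) (Gl : 'M[R]_M) (p : R).
Hypothesis As : symmetric_mx A.
Hypotheses (Gx_pd : posdef Gx) (Gl_pd : posdef Gl).

Let L := reg_lagrangian (objective A b c) (constraint D d) Gx Gl p.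

Lemma invmx_symmetric (m : nat) (B : 'M[R]_m) :
  symmetric_mx B -> symmetric_mx (invmx B).
Proof. by move=> Bs; rewrite /symmetric_mx trmx_inv Bs. Qed.

Lemma grad_lagrangian_x x lam :
  grad (fun x => L x lam) x = A *m x + D^T *m lam + p *: (invmx Gx *m x) + b.
Proof.
(* With [lam] frozen, the Lagrangian is a quadratic polynomial in [x]; the coupling term contributes
   [D^T *m lam] to its linear part. *)
have -> : (fun x => L x lam) = fun x =>
    quad (2^-1 *: A + (p / 2) *: invmx Gx) x + dot (b + D^T *m lam) x
    + (c + dot lam d - p / 2 * quad (invmx Gl) lam).
  apply/funext => y; rewrite /L /reg_lagrangian /objective /constraint.
  by rewrite quadD !quadZ dotDl dotDr dot_mul; ring.
rewrite grad_quadratic; last first.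
  by rewrite /symmetric_mx linearD !linearZ/= As (invmx_symmetric _ _ Gx_pd.1).
rewrite mulmxDl -!scalemxAl scalerDr !scalerA.
rewrite mulfV// scale1r mulrCA mulfV// mulr1.
by rewrite -!addrA; congr (_ + _); rewrite addrCA [X in _ + X]addrC addrCA addrA.
Qed.

Lemma grad_lagrangian_lam x lam :
  grad (fun lam => L x lam) lam = D *m x - p *: (invmx Gl *m lam) + d.
Proof.
have -> : (fun lam => L x lam) = fun lam =>
    quad ((- (p / 2)) *: invmx Gl) lam + dot (D *m x + d) lam
    + (objective A b c x + p / 2 * quad (invmx Gx) x).
  apply/funext => y; rewrite /L /reg_lagrangian /constraint.
  by rewrite quadZ (dotC y); ring.
rewrite grad_quadratic; last first.
  by rewrite /symmetric_mx linearZ/= (invmx_symmetric _ _ Gl_pd.1).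
rewrite -scalemxAl scalerA mulrN mulrCA mulfV// mulr1 scaleNr.
by rewrite addrA [- _ + _]addrC.
Qed.

(** Each diagonal block cancels its own inverse in the regularisation term. The sign flip of the
    dual gradient produces the [- D] of [Wmx], the [- d] of the constant, and [+ p] in both
    blocks. *)
Lemma saddle_mapE z :
  saddle_map L (block_diag Gx Gl) z =
    block_diag Gx Gl *m (Wmx A D *m z) + p *: z
    + block_diag Gx Gl *m col_mx b (- d).
Proof.
rewrite -[z]vsubmxK; move: (usubmx z) (dsubmx z) => x lam.
rewrite /saddle_map col_mxKu col_mxKd grad_lagrangian_x grad_lagrangian_lam.
rewrite /Wmx /block_diag !mul_block_col !mul0mx !addr0 !add0r.
rewrite scale_col_mx !add_col_mx !opprD opprK mulNmx !mulmxDr !mulmxN.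
by rewrite -!scalemxAr !mulmxA !mulmxV ?posdef_unitmx// !mul1mx.
Qed.

End SaddleMap.

(** * Strong monotonicity *)

Lemma quad_Vmx {R : realType} {m : nat} (G W : 'M[R]_m) u :
  symmetric_mx G -> quad (Vmx G W) u = dot u (G *m (W *m u)).
Proof.
move=> Gs; rewrite /Vmx quadZ quadD !quadE -!mulmxA.
(* Moving [W^T], then [G], across the product shows that both summands of [Vmx] have the same form
   value, which absorbs the factor 1/2. *)
rewrite [dot u (W^T *m _)]dot_mul trmxK [dot (W *m u) _]dot_mul Gs dotC.
by field.
Qed.

Theorem proposition4 (R : realType) (n M : nat)
    (A : 'M[R]_n) (b : 'cV[R]_n) (c : R) (D : 'M[R]_(M, n)) (d : 'cV[R]_M)
    (Gx : 'M[R]_n) (Gl : 'M[R]_M) (p lmin : R)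
    (A_psd : possemidef A)
    (Gx_diag : is_diag_mx Gx) (Gx_pd : posdef Gx)
    (Gl_diag : is_diag_mx Gl) (Gl_pd : posdef Gl)
    (lminP : smallest_eigenvalue (Vmx (block_diag Gx Gl) (Wmx A D)) lmin)
    (p_gt : Num.max 0 (- lmin) < p) :
  strongly_monotone (p + Num.min 0 lmin)
    (saddle_map
       (reg_lagrangian (objective A b c) (constraint D d) Gx Gl p)
       (block_diag Gx Gl)).
Proof.
have Gs : symmetric_mx (block_diag Gx Gl).
  by rewrite /symmetric_mx /block_diag tr_block_mx !trmx0 Gx_pd.1 Gl_pd.1.
have Vs : symmetric_mx (Vmx (block_diag Gx Gl) (Wmx A D)).
  by rewrite /symmetric_mx /Vmx linearZ linearD/= !trmx_mul trmxK Gs addrC.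
(* The parameter is the minimum of [p] and [p + lmin], both positive. *)
split; first by move: p_gt; rewrite gt_max addr_minr addr0 lt_min; lra.
move=> z1 z2; rewrite !saddle_mapE//; try exact: A_psd.1.
(* The constant terms cancel, leaving the linear part at [z1 - z2]. *)
rewrite opprD addrACA subrr addr0 opprD addrACA -scalerBr -!mulmxBr.
move: (z1 - z2) => u; rewrite norm2_sqr [leRHS]dotC dotDr dotZr -quad_Vmx//.
rewrite mulrDl [leRHS]addrC lerD2l.
apply: le_trans (smallest_eigenvalue_le_quad _ _ u Vs lminP).
by rewrite ler_wpM2r ?dot_ge0// ge_min lexx orbT.
Qed.
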